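(* Let $(S,\Sigma,\delta)$ be an HMM with $\epsilon$-transitions such that from each state there is an outgoing path of non-zero probability containing a symbol in $\Sigma$. For an observation sequence $\widetilde{y}=a_1\dots a_n\in\Sigma^n$ and $s_0,s\in S$ let $V^{\widetilde{y}}_{s_0,s}$ be the maximum probability of observing $\widetilde{y}$ and ending in $s$, i.e. $$V^{\widetilde{y}}_{s_0,s}=\max_{\widetilde{z}\in\Omega^n_{s_0},\ L(\widetilde{z})=s}P(Z=\widetilde{z}\land Y=\widetilde{y}).$$ Then for $n=0$ one has $V^{\epsilon}_{s_0,s}=1$ if $s=s_0$ and $V^{\epsilon}_{s_0,s}=0$ otherwise. For $n>0$, writing $\widetilde{y}=\widetilde{y}_1a_n$ with $\widetilde{y}_1=a_1\dots a_{n-1}$, $$V^{\widetilde{y}}_{s_0,s}=\max_{s'\in S}\ V^{\widetilde{y}_1}_{s_0,s'}\cdot\mathcal{E}^{a_n}_{s',s}.$$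
   Context: An HMM with $\epsilon$-transitions is a triple $(S,\Sigma,\delta)$ with a finite state space $S$, an alphabet $\Sigma$ (a finite set of observable symbols, with $\epsilon\notin\Sigma$) and a transition function $\delta\colon S\to\mathcal{D}((\Sigma\cup\{\epsilon\})\times S)$, where $\mathcal{D}(X)$ is the set of probability functions $P\colon X\to[0,1]$ with $\sum_{x}P(x)=1$. An outgoing path of $s$ of non-zero probability is a sequence $s=r_0,b_1,r_1,\dots,b_m,r_m$ with $r_i\in S$, $b_i\in\Sigma\cup\{\epsilon\}$ and $\delta(r_{i-1})(b_i,r_i)>0$ for all $i$; it contains a symbol in $\Sigma$ if some $b_i\in\Sigma$. For $s_0\in S$ and $n\in\mathbb{N}_0$, $\Omega^n_{s_0}=s_0((\epsilon S)^*\Sigma S)^n$ is the set of alternating sequences $\widetilde{z}=s_0a_1s_1\dots a_ms_m$ with $s_i\in S$, $a_i\in\Sigma\cup\{\epsilon\}$, exactly $n$ of the $a_i$ in $\Sigma$, and (if $n\ge1$) $a_m\in\Sigma$; $\Omega^0_{s_0}=\{s_0\}$. Its probability function is $P^n_{s_0}(\widetilde{z})=\prod_{i=1}^m\delta(s_{i-1})(a_i,s_i)$, with $P^0_{s_0}(s_0)=1$. Random variables on $\Omega^n_{s_0}$: $Z$ is the identity; $Y(\widetilde{z})\in\Sigma^n$ is the word of observable symbols of $\widetilde{z}$ (states and $\epsilon$'s removed); $L(\widetilde{z})\in S$ is the last state of $\widetilde{z}$. Thus $P(Z=\widetilde{z}\land Y=\widetilde{y})$ equals $P^n_{s_0}(\widetilde{z})$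 if $Y(\widetilde{z})=\widetilde{y}$ and $0$ otherwise, where $s_0$ is the first element of $\widetilde{z}$ and $n=|\widetilde{y}|$. As an observation sequence, $\epsilon$ denotes the empty word. A maximum over the empty set is $0$. For $a\in\Sigma$ and $r,s\in S$, $\mathcal{E}^a_{r,s}=\max_{\widetilde{z}\in\Omega^1_{r},\,L(\widetilde{z})=s}P(Z=\widetilde{z}\land Y=a)$ is the probability of the most likely path in $\Omega^1_r$ from $r$ to $s$ with observation $a$. *)

(* Defs.v *)
From mathcomp Require Import all_boot all_order all_algebra.
From mathcomp Require Import classical_sets reals.

Set Implicit Arguments.
Unset Strict Implicit.
Unset Printing Implicit Defensive.

Import Order.TTheory GRing.Theory Num.Theory.

Local Open Scope classical_set_scope.
Local Open Scope ring_scope.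

Record prob_fun (R : realType) (X : finType) := ProbFun {
  prob_of :> X -> R;
  prob_of_itv : forall x, 0 <= prob_of x <= 1;
  prob_of_sum1 : \sum_(x : X) prob_of x = 1 }.

Definition is_maximum (R : realType) (A : set R) (m : R) : Prop :=
  A m /\ ubound A m.

(* The value 0 is the convention for the empty set. It is also returned for a
   nonempty set without a greatest element, so uses of [max0] on infinite sets
   should come with [max0_wd]. *)
Definition max0 (R : realType) (A : set R) : R := xget 0 (is_maximum A).

Definition max0_wd (R : realType) (A : set R) : Prop :=
  A !=set0 -> exists m, is_maximum A m.

Section HMM.
Variables (R : realType) (S Sigma : finType).

(* [None] is the silent symbol epsilon. *)
Definition label : Type := option Sigma.

Definition step : Type := (label * S)%type.

(* s0 a1 s1 ... am sm is encoded as (s0, [:: (a1, s1); ...; (am, sm)]). *)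
Definition altseq : Type := (S * seq step)%type.

Definition observable (b : step) : bool := isSome b.1.

Definition first_state (z : altseq) : S := z.1.

Definition last_state (z : altseq) : S := last z.1 [seq b.2 | b <- z.2].

Definition obs_word (z : altseq) : seq Sigma := pmap fst z.2.

(* Elements of s0 ((epsilon S)^* Sigma S)^n. *)
Definition Omega (n : nat) (s0 : S) : set altseq :=
  [set z | first_state z = s0 /\
    if n is 0%N then z.2 = [::]
    else count observable z.2 = n /\ isSome (last None [seq b.1 | b <- z.2])].

Variable delta : S -> prob_fun R (label * S)%type.

Fixpoint positive_path (s : S) (p : seq step) : bool :=
  if p is b :: p' then (0 < delta s b) && positive_path b.2 p' else true.

Fixpoint steps_prob (s : S) (p : seq step) : R :=
  if p is b :: p' then delta s b * steps_prob b.2 p' else 1.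

Definition path_prob (z : altseq) : R := steps_prob (first_state z) z.2.

(* P(Z = z /\ Y = y) on Omega (size y) (first_state z). *)
Definition joint_prob (z : altseq) (y : seq Sigma) : R :=
  if obs_word z == y then path_prob z else 0.

Definition V_values (y : seq Sigma) (s0 s : S) : set R :=
  [set joint_prob z y | z in Omega (size y) s0 `&` [set z | last_state z = s]].

Definition V (y : seq Sigma) (s0 s : S) : R := max0 (V_values y s0 s).

Definition E_values (a : Sigma) (r s : S) : set R :=
  [set joint_prob z [:: a] | z in Omega 1 r `&` [set z | last_state z = s]].

Definition E (a : Sigma) (r s : S) : R := max0 (E_values a r s).

End HMM.

(* Main.v *)
(** All transition probabilities are at most 1, so cutting loops out of the
    silent part of a path does not decrease its probability.  Hence the maximum
    defining [E a r s] is reached on the finitely many paths whose silent part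
    visits no state twice.  A path emitting [rcons y1 a] splits, just after its
    last symbol but one, into a path emitting [y1] and a path emitting [a];
    this yields the recurrence and, inductively, the existence of the maximum
    defining [V]. *)
Require Import Defs.
From mathcomp Require Import all_boot all_order all_algebra.
From mathcomp Require Import classical_sets reals.

Set Implicit Arguments.
Unset Strict Implicit.
Unset Printing Implicit Defensive.

Import Order.TTheory GRing.Theory Num.Theory.

Local Open Scope ring_scope.

(** * Maxima of sets of nonnegative reals, with 0 for the empty set *)

Section MaxOrZero.
Variable R : realType.
Implicit Types (A : set R) (m : R).

(* For a set of nonnegative reals: [m] is its maximum, or [m = 0] and the set
   is empty. *)
Definition is_max0 A m : Prop := [/\ 0 <= m, ubound A m & m != 0 -> A m].

Lemma max0_eq A m : is_maximum A m -> max0 A = m.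
Proof.
move=> [Am ubm]; apply: xget_unique => // y [Ay uby].
by apply/le_anti; rewrite ubm // uby.
Qed.

(** If [m = 0], nonnegativity and the bound force every element of [A] to be 0, so 0 is either the
    maximum or the default value. *)
Lemma is_max0P A m : (forall x, A x -> 0 <= x) -> is_max0 A m ->
  max0 A = m /\ max0_wd A.
Proof.
move=> A_ge0 [m_ge0 ubm Am].
have mA x : A x -> is_maximum A m.
  move=> Ax; split=> //; have [m0|] := eqVneq m 0; last exact: Am.
  suff <- : x = m by [].
  by apply/le_anti; rewrite ubm // m0 A_ge0.
split; last by move=> [x /mA]; exists m.
have [m0|/Am/mA/max0_eq //] := eqVneq m 0.
rewrite /max0; case: xgetP => [y _ [Ay _]|_]; last by rewrite m0.
by apply/le_anti; rewrite ubm // m0 A_ge0.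
Qed.

Lemma is_max0_max0 A m : (forall x, A x -> 0 <= x) -> is_max0 A m ->
  is_max0 A (max0 A).
Proof. by move=> A_ge0 mP; have [-> _] := is_max0P A_ge0 mP. Qed.

(** Replaces a possibly infinite [A] by a finite family. Zero values are exempt on both sides, since
    0 is also the neutral element of the big maximum. *)
Lemma is_max0_bigmax (I : finType) (F : I -> R) A :
    (forall x, A x -> x != 0 -> exists i, x <= F i) ->
    (forall i, F i != 0 -> A (F i)) ->
  is_max0 A (\big[Num.max/0]_(i : I) F i).
Proof.
move=> leAF FA; split.
- exact: bigmax_ge_id.
- move=> x Ax; have [->|x0] := eqVneq x 0; first exact: bigmax_ge_id.
  by have [i /le_trans->//] := leAF x Ax x0; apply: le_bigmax.
- apply: (big_ind (fun m => m != 0 -> A m)) => [/eqP //|x y Ax Ay|i _].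
    by rewrite /Num.max; case: ifP.
  exact: FA.
Qed.

End MaxOrZero.

(** * Path probabilities, concatenation and observations *)

Section Paths.
Variables (R : realType) (S Sigma : finType).
Variable delta : S -> prob_fun R (option Sigma * S)%type.
Implicit Types (p q : seq (option Sigma * S)) (t : seq S) (y : seq Sigma).

Lemma delta_ge0 s b : 0 <= delta s b.
Proof. by have /andP[] := prob_of_itv (delta s) b. Qed.

Lemma delta_le1 s b : delta s b <= 1.
Proof. by have /andP[] := prob_of_itv (delta s) b. Qed.

Lemma steps_prob_ge0 s p : 0 <= steps_prob delta s p.
Proof. by elim: p s => //= b p IHp s; rewrite mulr_ge0 ?delta_ge0. Qed.

Lemma steps_prob_le1 s p : steps_prob delta s p <= 1.
Proof.
by elim: p s => //= b p IHp s; rewrite mulr_ile1 ?delta_ge0 ?delta_le1 ?steps_prob_ge0.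
Qed.

Definition end_state (s : S) p : S := last s [seq b.2 | b <- p].

Lemma end_state_cat s p q : end_state s (p ++ q) = end_state (end_state s p) q.
Proof. by rewrite /end_state map_cat last_cat. Qed.

Lemma steps_prob_cat s p q : steps_prob delta s (p ++ q) =
  steps_prob delta s p * steps_prob delta (end_state s p) q.
Proof. by elim: p s => [|b p IHp] s /=; rewrite ?mul1r // IHp mulrA. Qed.

(** The default [true] accepts the empty path, so that one condition covers both cases in [Omega]
    and is stable under concatenation. *)
Definition ends_observed p : bool :=
  last true [seq observable b | b <- p].

Lemma ends_observed_cat p q :
  ends_observed p -> ends_observed q -> ends_observed (p ++ q).
Proof.
rewrite /ends_observed map_cat last_cat => ->.
by case: q.
Qed.

Lemma split_last_observed p : exists q1 q2,
  [/\ p = q1 ++ q2, ends_observed q1 & pmap fst q2 = [::]].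
Proof.
elim/last_ind: p => [|p b [q1 [q2 [-> q1o q2e]]]]; first by exists [::], [::].
case: b => [[a|] s].
  exists (rcons (q1 ++ q2) (Some a, s)), [::]; split; rewrite ?cats0 //.
  by rewrite /ends_observed map_rcons last_rcons.
exists q1, (rcons q2 (None, s)); split; rewrite ?rcons_cat //.
by rewrite -cats1 pmap_cat q2e.
Qed.

Lemma ends_observed_rcons p y a :
    ends_observed p -> pmap fst p = rcons y a ->
  exists q s, p = rcons q (Some a, s) /\ pmap fst q = y.
Proof.
case/lastP: p => [|q [[c|] s]]; first by case: y.
  rewrite -[X in pmap _ X]cats1 pmap_cat /= cats1 => _ /rcons_inj[<- <-].
  by exists q, s.
by rewrite /ends_observed map_rcons last_rcons.
Qed.

Lemma pmap_eps p : pmap fst p = [::] -> exists t, p = [seq (None, s) | s <- t].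
Proof.
elim: p => [|[[a|] s] p IHp] //=; first by exists [::].
by move=> /IHp[t ->]; exists (s :: t).
Qed.

Lemma OmegaP p s0 y : pmap fst p = y ->
  Omega (size y) s0 (s0, p) <-> ends_observed p.
Proof.
move=> <-; have csz : count (@observable S Sigma) p = size (pmap fst p).
  by rewrite size_pmap; apply: eq_count.
rewrite /Omega /= /first_state /ends_observed /= -csz.
have lastE b q : isSome (last None [seq c.1 | c <- b :: q]) =
    last true [seq observable c | c <- b :: q].
  by elim: q b => [|c q IHq] b //; apply: IHq.
case: p {csz} => [|b q] //; split.
  by case=> _; case: (count _ _) => // n [_]; rewrite lastE.
move=> lb; split=> //; case cE: (count _ _) => [|n]; last by rewrite lastE.
(* A nonempty path ending in a symbol cannot have symbol count 0. *)
suff : has (@observable S Sigma) (b :: q) by rewrite has_count cE.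
elim: q b lb {cE} => [|c q IHq] b /= lb; first by rewrite orbF.
by have /= -> := IHq c lb; rewrite orbT.
Qed.

(** Requiring [x != 0] discards the zeros that [joint_prob] assigns to paths with another
    observation. *)
Lemma V_valuesP y s0 s x : x != 0 ->
  V_values delta y s0 s x <->
  exists p, [/\ pmap fst p = y, ends_observed p, end_state s0 p = s
               & steps_prob delta s0 p = x].
Proof.
move=> x0; split=> [[[s1 p] [/= Om ls]]|[p [py op es <-]]].
  have s10 : s1 = s0 by case: Om.
  subst s1; rewrite /joint_prob /obs_word /=; case: eqP => [py <-|_ x0'].
    by exists p; split=> //; apply/(OmegaP s0 py).
  by rewrite x0' eqxx in x0.
exists (s0, p) => /=.
  by split=> //; apply/(OmegaP s0 py).
by rewrite /joint_prob /obs_word /= py eqxx.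
Qed.

Lemma V_values_ge0 y s0 s x : V_values delta y s0 s x -> 0 <= x.
Proof.
by move=> [z _ <-]; rewrite /joint_prob; case: ifP => // _; apply: steps_prob_ge0.
Qed.

(** * Silent paths and removal of loops *)

Definition eps_path t : seq (option Sigma * S) := [seq (None, s) | s <- t].

Lemma end_state_eps s t : end_state s (eps_path t) = last s t.
Proof. by rewrite /end_state -map_comp map_id. Qed.

Lemma pmap_eps_path t : pmap fst (eps_path t) = [::].
Proof. by elim: t. Qed.

(** Induction on [t]: make the tail loop-free first; if it still meets [s], keep only what follows
    that visit. *)
Lemma eps_path_shorten s t : exists t',
  [/\ uniq (s :: t'), last s t' = last s t &
      steps_prob delta s (eps_path t) <= steps_prob delta s (eps_path t')].
Proof.
elim: t s => [|r t IHt] s; first by exists [::].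
have [t' [ut' lt' le_t']] := IHt r.
have [|s_nin] := boolP (s \in r :: t'); last first.
  exists (r :: t'); split=> //; first by rewrite /= s_nin.
  by rewrite /= ler_wpM2l ?delta_ge0.
move=> s_in; have le_r : steps_prob delta s (eps_path (r :: t)) <=
    steps_prob delta s (eps_path (r :: t')).
  by rewrite /= ler_wpM2l ?delta_ge0.
have last_r : last s (r :: t') = last s (r :: t) by [].
move: ut' le_r last_r; case/splitPr: s_in => t1 t2.
rewrite cat_uniq => /and3P[_ _ ut2] le_r last_r.
exists t2; split=> //; first by rewrite -last_r last_cat.
(* The removed loop from [s] through [t1] back to [s] contributes a factor at most 1. *)
apply: le_trans le_r _; rewrite /eps_path map_cat steps_prob_cat /=.
by rewrite end_state_eps mulrA ler_piMl ?steps_prob_ge0 // mulr_ile1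
  ?steps_prob_ge0 ?steps_prob_le1 ?delta_ge0 ?delta_le1.
Qed.

Lemma V_values1_is_max0 a r s :
  exists m, is_max0 (V_values delta [:: a] r s) m.
Proof.
pose p t := rcons (eps_path t) (Some a, s).
have pP t : [/\ pmap fst (p t) = [:: a], ends_observed (p t) & end_state r (p t) = s].
  rewrite /ends_observed /end_state /p !map_rcons !last_rcons -cats1 pmap_cat.
  by rewrite pmap_eps_path.
have probE t : steps_prob delta r (p t) =
    steps_prob delta r (eps_path t) * delta (last r t) (Some a, s).
  by rewrite /p -cats1 steps_prob_cat end_state_eps /= mulr1.
(* A repetition-free list of states has length at most [#|S|], so lists of bounded length form a
   large enough finite index type. *)
exists (\big[Num.max/0]_(t : #|S|.-bseq S) steps_prob delta r (p t)).
apply: is_max0_bigmax.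
  move=> x + x0 => /(V_valuesP _ _ _ x0)[q [qa oq es <-]].
  have [q' [s' [qE /pmap_eps[t q't]]]] := @ends_observed_rcons q [::] a oq qa.
  have {}es : s' = s by rewrite -es qE /end_state map_rcons last_rcons.
  have -> : q = p t by rewrite qE q't es.
  have [t' [/= /andP[_ ut'] lt' le_t']] := eps_path_shorten r t.
  have szt' : (size t' <= #|S|)%N by rewrite -(card_uniqP ut') max_card.
  by exists (Bseq szt'); rewrite !probE /= lt' ler_wpM2r ?delta_ge0.
by move=> t p0; apply/V_valuesP => //; exists (p t); case: (pP t).
Qed.

(** * The empty word and the recurrence *)

Lemma V_values0_is_max0 s0 s :
  is_max0 (V_values delta [::] s0 s) (if s == s0 then 1 else 0).
Proof.
split.
- by case: eqP.
- move=> x; have [->|x0] := eqVneq x 0; first by case: eqP.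
  move=> /(V_valuesP _ _ _ x0)[p [p0 op <- <-]].
  have [t pt] := pmap_eps p0; suff -> : p = [::] by rewrite /end_state /= eqxx.
  (* A nonempty silent path would end in an epsilon step. *)
  move: op; rewrite pt /ends_observed; case/lastP: t {pt} => // t r.
  by rewrite !map_rcons last_rcons.
- case: (s =P s0) => [-> _|_]; last by rewrite eqxx.
  by apply/V_valuesP; [exact: oner_neq0 | exists [::]].
Qed.

Lemma V_values_rcons_is_max0 y a s0 s (m e : S -> R) :
    (forall s', is_max0 (V_values delta y s0 s') (m s')) ->
    (forall s', is_max0 (V_values delta [:: a] s' s) (e s')) ->
  is_max0 (V_values delta (rcons y a) s0 s) (\big[Num.max/0]_(s' : S) (m s' * e s')).
Proof.
move=> mP eP; apply: is_max0_bigmax => [x|s'].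
  move=> + x0 => /(V_valuesP _ _ _ x0)[p [py op es xE]].
  have [q [r [pE qy]]] := ends_observed_rcons op py.
  (* [q] precedes the final symbol; its silent tail [q2] is attached to that symbol, and [q1] emits
     [y]. The end of [q1] is the intermediate state. *)
  have [q1 [q2 [qE oq1 q2e]]] := split_last_observed q.
  have {}pE : p = q1 ++ rcons q2 (Some a, r) by rewrite pE qE rcons_cat.
  move: xE x0; rewrite pE steps_prob_cat => <-; rewrite mulf_eq0 negb_or.
  move=> /andP[p1_neq0 p2_neq0]; exists (end_state s0 q1).
  have [m_ge0 ubm _] := mP (end_state s0 q1).
  have [e_ge0 ube _] := eP (end_state s0 q1).
  apply: ler_pM; rewrite ?steps_prob_ge0 //.
    apply: ubm; apply/V_valuesP => //; exists q1; split=> //.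
    by rewrite -qy qE pmap_cat q2e cats0.
  apply: ube; apply/V_valuesP => //; exists (rcons q2 (Some a, r)); split=> //.
  - by rewrite -cats1 pmap_cat q2e.
  - by rewrite /ends_observed map_rcons last_rcons.
  - by rewrite -end_state_cat -pE.
(* Both factors being nonzero, each is attained by a path, and the two paths are concatenated. *)
rewrite mulf_eq0 negb_or => /andP[m_neq0 e_neq0].
have [_ _ /(_ m_neq0)/(V_valuesP _ _ _ m_neq0)[p [py op ep mE]]] := mP s'.
have [_ _ /(_ e_neq0)/(V_valuesP _ _ _ e_neq0)[q [qa oq eq eE]]] := eP s'.
apply/V_valuesP; first by rewrite mulf_neq0.
exists (p ++ q); split.
- by rewrite pmap_cat py qa cats1.
- exact: ends_observed_cat.
- by rewrite end_state_cat ep.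
- by rewrite steps_prob_cat ep mE eE.
Qed.

(** [E_values] and [V_values] on a one-letter word are convertible, as [size [:: a]] computes to
    1. *)
Lemma E_values_is_max0 a r s : is_max0 (V_values delta [:: a] r s) (E delta a r s).
Proof.
have [m] := V_values1_is_max0 a r s.
exact/is_max0_max0/V_values_ge0.
Qed.

(** Induction from the right end of [y], for all final states at once because the recurrence ranges
    over every intermediate state. *)
Lemma V_values_is_max0 y s0 s : is_max0 (V_values delta y s0 s) (V delta y s0 s).
Proof.
elim/last_ind: y s => [|y a IHy] s.
  exact: is_max0_max0 (@V_values_ge0 _ _ _) (V_values0_is_max0 s0 s).
apply: is_max0_max0 (@V_values_ge0 _ _ _) _.
  apply: V_values_rcons_is_max0 => s'; first exact: IHy.
  exact: E_values_is_max0.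
Qed.

End Paths.

Theorem proposition4p2 (R : realType) (S Sigma : finType)
    (delta : S -> prob_fun R (option Sigma * S)%type)
    (hobs : forall s : S, exists p : seq (option Sigma * S),
        positive_path delta s p /\ has (@observable S Sigma) p) :
  [/\ forall (y : seq Sigma) (s0 s : S), max0_wd (V_values delta y s0 s),
      forall (a : Sigma) (r s : S), max0_wd (E_values delta a r s),
      forall s0 s : S, V delta [::] s0 s = if s == s0 then 1 else 0
    & forall (y1 : seq Sigma) (a : Sigma) (s0 s : S),
        V delta (rcons y1 a) s0 s
        = \big[Num.max/0]_(s' : S) (V delta y1 s0 s' * E delta a s' s)].
Proof.
have V_wd y s0 s : max0_wd (V_values delta y s0 s).
  exact: (is_max0P (@V_values_ge0 _ _ _ _ y s0 s) (V_values_is_max0 _ y s0 s)).2.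
split=> // [a r s|s0 s|y1 a s0 s]; first exact: (V_wd [:: a]).
  exact: (is_max0P (@V_values_ge0 _ _ _ _ [::] s0 s) (V_values0_is_max0 _ s0 s)).1.
apply: (is_max0P (@V_values_ge0 _ _ _ _ (rcons y1 a) s0 s) _).1.
apply: V_values_rcons_is_max0 => s'; first exact: V_values_is_max0.
exact: E_values_is_max0.
Qed.
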